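(* Let $n$ be a positive integer, let $\alpha$ be an umbra, and let $\alpha_1,\ldots,\alpha_n$ be pairwise uncorrelated umbrae, each similar to $\alpha$. Then for every integer $i$ with $1\le i\le n$, $$(\chi.\alpha)^i\;\simeq\;\sum_{k=1}^{i}(-1)^{k-1}\,\frac{(k-1)!}{(n)_k}\sum_{\pi\in\Pi_{i,k}} n.(\chi\,\alpha^{n_1})\;n.(\chi\,\alpha^{n_2})\cdots n.(\chi\,\alpha^{n_k}),$$ where $\Pi_{i,k}$ is the set of all partitions of the set $\{1,2,\ldots,i\}$ into $k$ blocks and, for $\pi=\{A_1,\ldots,A_k\}\in\Pi_{i,k}$, $n_j=|A_j|$ for $j=1,\ldots,k$.
   Context: Umbral calculus. $A$ is an alphabet whose elements are called umbrae; $R$ is a commutative integral domain whose quotient field $K$ has characteristic zero; $E:R[A]\to R$ is an $R$-linear functional (evaluation) with $E[1]=1$ and $E[\alpha^i\beta^j\cdots\gamma^k]=E[\alpha^i]E[\beta^j]\cdots E[\gamma^k]$ for distinct umbrae $\alpha,\beta,\ldots,\gamma\in A$ and non-negative integers $i,j,\ldots,k$. $E$ is extended $K$-linearly to $K[A]$, so that rational coefficients make sense. An element of $R[A]$ is an umbral polynomial; its support is the set of umbrae occurring in it; umbral polynomials are uncorrelated when their supports are disjoint. Two umbral polynomials $p,q$ are umbrally equivalent, $p\simeq q$, if $E[p]=E[q]$. Two umbrae $\alpha,\gamma$ are similar, $\alpha\equiv\gamma$, if $E[\alpha^i]=E[\gamma^i]$ for all $i\ge1$. The $i$-th moment of $\alpha$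 is $a_i=E[\alpha^i]$. The singleton umbra $\chi$ has $E[\chi]=1$ and $E[\chi^i]=0$ for $i\ge2$. Let $\chi_1,\ldots,\chi_n$ be pairwise uncorrelated umbrae similar to $\chi$ and also uncorrelated with $\alpha_1,\ldots,\alpha_n$. For every $r\ge1$, $n.(\chi\alpha^r)$ denotes $\chi_1\alpha_1^r+\cdots+\chi_n\alpha_n^r$, with the same $\chi_j$ and $\alpha_j$ used for all $r$ (so these polynomials are correlated with one another). For umbrae $\gamma,\alpha$, the symbol $\gamma.\alpha$ denotes an auxiliary umbra with moments $$E[(\gamma.\alpha)^i]=\sum_{k=1}^i g_{(k)}\,B_{i,k}(a_1,a_2,\ldots,a_{i-k+1}),\qquad i\ge1,$$ where $g_{(k)}=E[\gamma(\gamma-1)\cdots(\gamma-k+1)]$ is the $k$-th factorial moment of $\gamma$ and $B_{i,k}(a_1,a_2,\ldots)=\sum_{\{A_1,\ldots,A_k\}\in\Pi_{i,k}}a_{|A_1|}\cdots a_{|A_k|}$ is the incomplete exponential Bell polynomial. The umbra $\chi.\alpha$ is called the $\alpha$-cumulant umbra; its $i$-th moment is the $i$-th cumulant of the moment sequence $(a_j)$. $(n)_k=n(n-1)\cdots(n-k+1)$ is the falling factorial. *)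

(* Defs.v *)
From HB Require Import structures.
From mathcomp Require Import all_boot all_order all_algebra.
From mathcomp Require Import finmap.
From mathcomp.multinomials Require Import monalg.

Set Implicit Arguments.
Unset Strict Implicit.
Unset Printing Implicit Defensive.

Import GRing.Theory.
Local Open Scope ring_scope.

(* Polynomials with coefficients in R in the commuting variables A: finitely
   supported combinations of the monomials {cmonom A}. *)
Notation umbral_poly R A := {malg R[{cmonom A}]}.

Section Polynomials.
Variables (R : comNzRingType) (A : choiceType).
Implicit Types p q : umbral_poly R A.

Definition umbra (a : A) : umbral_poly R A := << ucm a >>.

Definition usupp p : {fset A} :=
  \big[fsetU/fset0]_(m <- msupp p) finsupp (cmonom_val m).

Definition uncorrelated p q : Prop := [disjoint usupp p & usupp q]%fset.

(* The symbol n.(chi alpha^r) of the umbral calculus. *)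
Definition dot_power_sum (n : nat) (chis alphas : 'I_n -> A) (r : nat) :
    umbral_poly R A :=
  \sum_(j < n) umbra (chis j) * umbra (alphas j) ^+ r.

End Polynomials.

Arguments umbra R {A} a.
Arguments dot_power_sum R {A n} chis alphas r.

Definition set_partitions (i k : nat) : {set {set {set 'I_i}}} :=
  [set P | partition P [set: 'I_i] & #|P| == k].

Definition bell_poly (R : comNzRingType) (i k : nat) (a : nat -> R) : R :=
  \sum_(P in set_partitions i k) \prod_(B in P) a #|B|.

Section Evaluation.
Variables (R : idomainType) (A : choiceType).
Variable E : {scalar (umbral_poly R A)}.

Definition evaluation : Prop :=
  E 1 = 1 /\
  forall (s : seq A) (e : A -> nat), uniq s ->
    E (\prod_(a <- s) umbra R a ^+ e a) = \prod_(a <- s) E (umbra R a ^+ e a).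

Definition moment (a : A) (i : nat) : R := E (umbra R a ^+ i).

Definition factorial_moment (g : A) (k : nat) : R :=
  E (\prod_(j < k) (umbra R g - j%:R)).

Definition umbrae_similar (a c : A) : Prop :=
  forall i : nat, (0 < i)%N -> moment a i = moment c i.

Definition singleton_umbra (c : A) : Prop :=
  moment c 1 = 1 /\ forall i : nat, (2 <= i)%N -> moment c i = 0.

(* d plays the role of the auxiliary umbra g.a, which is only determined by its
   moments. *)
Definition dot_umbra (g a d : A) : Prop :=
  forall i : nat, (0 < i)%N ->
    moment d i =
    \sum_(1 <= k < i.+1) factorial_moment g k * bell_poly i k (moment a).

(* The K-linear extension of E to K[A], with K the field of fractions of R:
   the sum over the monomials m of p of (coefficient of m) * E[m]. *)
Definition Efrac (p : umbral_poly {fraction R} A) : {fraction R} :=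
  mmap idfun (fun m : {cmonom A} => tofrac (E << m >>)) p.

Lemma Efrac_linear (c : {fraction R}) (p q : umbral_poly {fraction R} A) :
  Efrac (c *: p + q) = c * Efrac p + Efrac q.
Proof.
rewrite /Efrac mmapD; congr (_ + _).
rewrite (mmapEw (msuppZ_le _ _)) mmapE big_distrr /=.
by apply: eq_bigr => m _; rewrite mcoeffZ mulrA.
Qed.

Lemma Efrac_tofrac (c : R) (m : {cmonom A}) :
  Efrac << tofrac c *g m >> = tofrac (E << c *g m >>).
Proof.
have -> : << c *g m >> = c *: << m >> :> umbral_poly R A.
  apply/malgP => k; rewrite [RHS]mcoeffZ [LHS]mcoeffU mcoeffU.
  by case: (m == k); rewrite ?mulr1n ?mulr1 ?mulr0n ?mulr0.
by rewrite /Efrac mmapU [in RHS]linearZ tofracM.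
Qed.

Definition umbral_equiv (p q : umbral_poly {fraction R} A) : Prop :=
  Efrac p = Efrac q.

End Evaluation.

(* Main.v *)
Require Import Defs.
From mathcomp Require Import all_boot all_order all_algebra.
From mathcomp Require Import finmap.
From mathcomp.multinomials Require Import monalg.

Set Implicit Arguments.
Unset Strict Implicit.
Unset Printing Implicit Defensive.

Import GRing.Theory.
Local Open Scope ring_scope.

(** The evaluation of a product [n.(chi alpha^(r 1)) ... n.(chi alpha^(r k))]
    of correlated power sums keeps only the terms in which the [k] factors
    choose pairwise distinct indices among the [n] available ones: a term that
    repeats an index [j] contains [chi_j] to a power at least 2, and these
    moments vanish.  Each of the [n (n - 1) ... (n - k + 1)] surviving terms
    evaluates to [a_(r 1) ... a_(r k)], because distinct umbrae are
    uncorrelated ([Efrac_prod_dot_power_sum]).  The falling factorial in the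
    denominator of the statement, nonzero since [k <= n] in characteristic
    zero, cancels this count, and the inner sum over partitions becomes a
    partial Bell polynomial in the moments of [alpha].

    On the other side, [E] maps a polynomial in [chi] to its coefficient of
    degree 1 when it has no constant term, so the [k]-th factorial moment of
    [chi] is the product of the constants [-1, ..., -(k - 1)]
    ([factorial_moment_singleton]).  Hence the weights [(-1)^(k-1) (k-1)!] are
    the factorial moments in the definition of [chi.alpha], and the two sides
    agree term by term in [k]. *)

(** * Umbrae as monomials *)

Lemma usupp_umbra (R : comNzRingType) (A : choiceType) (a : A) :
  usupp (umbra R a) = [fset a]%fset.
Proof. by rewrite /usupp /umbra msuppU oner_eq0 big_seq_fset1 mdomU. Qed.

Lemma uncorrelated_umbra (R : comNzRingType) (A : choiceType) (a b : A) :
  uncorrelated (umbra R a) (umbra R b) -> a != b.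
Proof.
move=> unc; apply/eqP=> eq_ab; move: unc.
by rewrite -eq_ab /uncorrelated usupp_umbra fdisjoint1X in_fset1 eqxx.
Qed.

(** Working with both coefficient rings at once avoids naming the monomial;
    this is what lets [Efrac] and [E] be compared on products of umbrae. *)
Lemma prod_umbra_monomial (R S : comNzRingType) (A : choiceType)
    (I : finType) (c : I -> A) (e : I -> nat) :
  exists m : {cmonom A},
    \prod_(x : I) umbra R (c x) ^+ e x = << m >> /\
    \prod_(x : I) umbra S (c x) ^+ e x = << m >>.
Proof.
pose same p q := exists m : {cmonom A},
  p = << m >> :> umbral_poly R A /\ q = << m >> :> umbral_poly S A.
have same1 : same 1 1 by exists mone.
have sameM p q p' q' : same p q -> same p' q' -> same (p * p') (q * q').
  move=> [m [-> ->]] [m' [-> ->]]; exists (mmul m m').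
  by rewrite !malgM_def !fgmulUU !mulr1.
have sameX p q d : same p q -> same (p ^+ d) (q ^+ d).
  move=> pq; elim: d => [|d IHd]; first by rewrite !expr0.
  by rewrite !exprS; apply: sameM.
apply: (big_rec2 same) => // x p q _; apply: sameM; apply: sameX.
by exists (ucm (c x)).
Qed.

(** * Falling factorials of the singleton umbra *)

(** [L] annihilates every power of [x] above the first; the additional power
    [x ^+ d] makes the induction on the number of linear factors go through. *)
Lemma singleton_linear_factors (R : comNzRingType) (S : comAlgType R)
    (L : {scalar S}) (x : S) (c : nat -> R) k d :
    (forall d, L (x ^+ d.+1) = (d == 0)%:R) ->
  L (x ^+ d.+1 * \prod_(j < k) (x - (c j)%:A)) =
    (d == 0)%:R * \prod_(j < k) - c j.
Proof.
move=> Lx; elim: k d => [|k IHk] d; first by rewrite !big_ord0 !mulr1.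
rewrite !big_ord_recr /= mulrA mulrBr linearB /=.
rewrite mulrAC -exprSr IHk mul0r sub0r mulr_algr linearZ /= IHk.
by rewrite !mulrN mulrCA [c k * _]mulrC.
Qed.

Lemma singleton_falling_factorial (R : comNzRingType) (S : comAlgType R)
    (L : {scalar S}) (x : S) k :
    (forall d, L (x ^+ d.+1) = (d == 0)%:R) ->
  L (\prod_(j < k.+1) (x - j%:R)) = (-1) ^+ k * k`!%:R.
Proof.
move=> Lx; rewrite big_ord_recl /= subr0.
have := singleton_linear_factors (fun j => j.+1%:R) k 0 Lx.
rewrite expr1 eqxx mul1r prodrN card_ord -natr_prod.
rewrite fact_prod big_add1 big_mkord => <-.
by congr (L (_ * _)); apply: eq_bigr => j _; rewrite scaler_nat.
Qed.

(** * Products of power sums *)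

(** Expanding amounts to choosing an index [f l] in each factor; the terms are
    then sorted by index. *)
Lemma prod_power_sums (S : comNzRingType) (I J : finType) (x y : J -> S)
    (r : I -> nat) :
  \prod_(l : I) \sum_(j : J) x j * y j ^+ r l =
  \sum_(f : {ffun I -> J})
    (\prod_(j : J) x j ^+ #|[pred l | f l == j]|) *
    (\prod_(j : J) y j ^+ (\sum_(l | f l == j) r l)%N).
Proof.
rewrite bigA_distr_bigA; apply: eq_bigr => f _; rewrite big_split /=.
congr (_ * _); rewrite (partition_big f predT) //=; apply: eq_bigr => j _.
  rewrite -prodr_const; apply: eq_bigr => l /eqP -> //.
by rewrite -prodrXr; apply: eq_bigr => l /eqP ->.
Qed.

(** [c] and [a] stand for the moments of [chi] and [alpha]; the left-hand side
    is the evaluation of one term of the expansion in [prod_power_sums]. *)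
Lemma prod_fiber_moments (R : comNzRingType) (c a : nat -> R) (I J : finType)
    (f : {ffun I -> J}) (r : I -> nat) :
    c 0 = 1 -> c 1 = 1 -> (forall d, (1 < d)%N -> c d = 0) -> a 0 = 1 ->
  (\prod_(j : J) c #|[pred l | f l == j]|) *
  (\prod_(j : J) a (\sum_(l | f l == j) r l)%N) =
  if injectiveb f then \prod_(l : I) a (r l) else 0.
Proof.
move=> c0 c1 c2 a0.
case: injectiveP => [inj_f | /injectiveP ninj_f]; last first.
  case/injectivePn: ninj_f => l [l' ne_ll' eq_f].
  rewrite (bigD1 (f l)) //= c2 ?mul0r //.
  by apply/card_gt1P; exists l, l'; split; rewrite // inE ?eq_f eqxx.
(* An injective [f] has fibers of size at most 1, and in both cases the moment
   of [alpha] attached to the fiber is the product over its elements, empty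
   when the fiber is. *)
have fiber l : [pred l' | f l' == f l] =1 pred1 l.
  by move=> l' /=; rewrite inj_eq.
rewrite big1 ?mul1r => [|j _].
  rewrite [RHS](partition_big f predT) //=; apply: eq_bigr => j _.
  case: (pickP [pred l | f l == j]) => [l /= /eqP <- | no_l].
    by rewrite !(eq_bigl _ _ (fiber l)) !big_pred1_eq.
  by rewrite !big_pred0.
case: (pickP [pred l | f l == j]) => [l /= /eqP <- | no_l].
  by rewrite (eq_card (fiber l)) card1.
by rewrite (eq_card0 no_l).
Qed.

(** * Evaluation *)

Section Evaluation.
Variables (R : idomainType) (A : choiceType) (E : {scalar (umbral_poly R A)}).
Hypothesis hE : evaluation E.

Lemma moment0 a : moment E a 0 = 1.
Proof. by rewrite /moment expr0; case: hE. Qed.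

Lemma umbrae_similar_moment a b :
  umbrae_similar E a b -> moment E a =1 moment E b.
Proof. by move=> sim [|d]; [rewrite !moment0 | exact: sim]. Qed.

(** The list form of the independence axiom gives one exponent to each umbra,
    whence the lookup [e'] of the exponent from the umbra. *)
Lemma evaluation_prod (I : finType) (c : I -> A) (e : I -> nat) :
  injective c ->
  E (\prod_(x : I) umbra R (c x) ^+ e x) = \prod_(x : I) moment E (c x) (e x).
Proof.
move=> inj_c; pose e' a := if [pick x | c x == a] is Some x then e x else 0%N.
have e'E x : e' (c x) = e x.
  rewrite /e'; case: pickP => [y /eqP/inj_c -> // | /(_ x)].
  by rewrite eqxx.
have uniq_c : uniq [seq c x | x <- index_enum I].
  by rewrite map_inj_uniq // index_enum_uniq.
have [_ /(_ _ e' uniq_c)] := hE.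
rewrite !big_map; under eq_bigr do rewrite e'E.
by under [in RHS]eq_bigr do rewrite e'E.
Qed.

Lemma Efrac_prod (I : finType) (c : I -> A) (e : I -> nat) : injective c ->
  Efrac E (\prod_(x : I) umbra {fraction R} (c x) ^+ e x) =
    tofrac (\prod_(x : I) moment E (c x) (e x)).
Proof.
move=> inj_c; rewrite -evaluation_prod //.
have [m [-> ->]] := prod_umbra_monomial R {fraction R} c e.
by rewrite -Efrac_tofrac tofrac1.
Qed.

Lemma Efrac_sum (I : Type) (s : seq I) (P : pred I)
    (F : I -> umbral_poly {fraction R} A) :
  Efrac E (\sum_(x <- s | P x) F x) = \sum_(x <- s | P x) Efrac E (F x).
Proof. exact: raddf_sum. Qed.

Lemma EfracZ c (p : umbral_poly {fraction R} A) :
  Efrac E (c *: p) = c * Efrac E p.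
Proof. by rewrite -[c *: p]addr0 Efrac_linear /Efrac raddf0 addr0. Qed.

Lemma Efrac_umbraX a d :
  Efrac E (umbra {fraction R} a ^+ d) = tofrac (moment E a d).
Proof.
have := @Efrac_prod 'I_1 (fun=> a) (fun=> d).
by rewrite !big_ord1 => -> // x y _; rewrite !ord1.
Qed.

Lemma factorial_moment_singleton chi k : singleton_umbra E chi ->
  factorial_moment E chi k.+1 = (-1) ^+ k * k`!%:R.
Proof.
move=> [chi1 chi2]; apply: singleton_falling_factorial => -[|d].
  exact: chi1.
exact: chi2.
Qed.

Section DotPowerSums.
Variables (n : nat) (chi alpha : A) (chis alphas : 'I_n -> A).
Hypothesis chiP : singleton_umbra E chi.
Hypothesis alphas_sim : forall j, umbrae_similar E (alphas j) alpha.
Hypothesis alphas_unc : forall j l, j != l ->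
  uncorrelated (umbra R (alphas j)) (umbra R (alphas l)).
Hypothesis chis_sim : forall j, umbrae_similar E (chis j) chi.
Hypothesis chis_unc : forall j l, j != l ->
  uncorrelated (umbra R (chis j)) (umbra R (chis l)).
Hypothesis chis_alphas : forall j l,
  uncorrelated (umbra R (chis j)) (umbra R (alphas l)).

(** A single injective family, so that the independence axiom applies to the
    [chi_j] and the [alpha_j] together. *)
Definition chis_or_alphas (x : 'I_n + 'I_n) : A :=
  match x with inl j => chis j | inr j => alphas j end.

Lemma chis_or_alphas_inj : injective chis_or_alphas.
Proof.
move=> [j|j] [l|l] /= eq_jl.
- congr inl; apply/eqP/contraT => /chis_unc/uncorrelated_umbra.
  by rewrite eq_jl eqxx.
- by have := uncorrelated_umbra (chis_alphas j l); rewrite eq_jl eqxx.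
- by have := uncorrelated_umbra (chis_alphas l j); rewrite eq_jl eqxx.
- congr inr; apply/eqP/contraT => /alphas_unc/uncorrelated_umbra.
  by rewrite eq_jl eqxx.
Qed.

Lemma Efrac_chis_alphas (d e : 'I_n -> nat) :
  Efrac E ((\prod_j umbra {fraction R} (chis j) ^+ d j) *
           (\prod_j umbra {fraction R} (alphas j) ^+ e j)) =
  tofrac ((\prod_j moment E chi (d j)) * (\prod_j moment E alpha (e j))).
Proof.
pose de (x : 'I_n + 'I_n) := match x with inl j => d j | inr j => e j end.
have := Efrac_prod de chis_or_alphas_inj; rewrite !big_sumType /= => ->.
apply: (f_equal2 (fun p q => tofrac (p * q))).
  by apply: eq_bigr => j _; apply: umbrae_similar_moment (chis_sim j) _.
by apply: eq_bigr => j _; apply: umbrae_similar_moment (alphas_sim j) _.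
Qed.

(** The injective choices of an index in each factor are the only ones that
    contribute, all equally, and there are [n ^_ #|I|] of them. *)
Lemma Efrac_prod_dot_power_sum (I : finType) (r : I -> nat) :
  Efrac E (\prod_(l : I) dot_power_sum {fraction R} chis alphas (r l)) =
  (n ^_ #|I|)%:R * tofrac (\prod_(l : I) moment E alpha (r l)).
Proof.
have [chi1 chi2] := chiP; rewrite /dot_power_sum prod_power_sums Efrac_sum.
transitivity (\sum_(f : {ffun I -> 'I_n})
    if injectiveb f then tofrac (\prod_(l : I) moment E alpha (r l)) else 0).
  apply: eq_bigr => f _; rewrite Efrac_chis_alphas.
  rewrite (prod_fiber_moments f r (moment0 chi) chi1 chi2 (moment0 alpha)).
  by case: ifP => // _; apply: tofrac0.
rewrite -big_mkcond sumr_const mulr_natl; congr (_ *+ _).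
by rewrite -[in RHS](card_ord n) -card_inj_ffuns cardsE.
Qed.

End DotPowerSums.

End Evaluation.

Theorem mainTheorem2
  (R : idomainType) (hR : [pchar {fraction R}] =i pred0)
  (A : choiceType) (E : {scalar (umbral_poly R A)}) (hE : evaluation E)
  (n : nat) (hn : (0 < n)%N)
  (chi : A) (hchi : singleton_umbra E chi)
  (alpha : A)
  (alphas : 'I_n -> A)
  (halphas_sim : forall j, umbrae_similar E (alphas j) alpha)
  (halphas_unc : forall j l, j != l ->
     uncorrelated (umbra R (alphas j)) (umbra R (alphas l)))
  (chis : 'I_n -> A)
  (hchis_sim : forall j, umbrae_similar E (chis j) chi)
  (hchis_unc : forall j l, j != l ->
     uncorrelated (umbra R (chis j)) (umbra R (chis l)))
  (hchis_alphas : forall j l,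
     uncorrelated (umbra R (chis j)) (umbra R (alphas l)))
  (chi_dot_alpha : A) (hdot : dot_umbra E chi alpha chi_dot_alpha)
  (i : nat) (hi1 : (1 <= i)%N) (hin : (i <= n)%N) :
  umbral_equiv E
    (umbra {fraction R} chi_dot_alpha ^+ i)
    (\sum_(1 <= k < i.+1)
       ((-1) ^+ (k - 1) * ((k - 1)`!)%:R / (n ^_ k)%:R : {fraction R}) *:
       \sum_(P in set_partitions i k)
         \prod_(B in P) dot_power_sum {fraction R} chis alphas #|B|).
Proof.
rewrite /umbral_equiv Efrac_umbraX // hdot // Efrac_sum rmorph_sum /=.
apply: eq_big_nat => -[|k] /andP [// _ le_ki].
have nz : (n ^_ k.+1)%:R != 0 :> {fraction R}.
  by rewrite (pcharf0P _).1 // -lt0n ffact_gt0 (leq_trans _ hin).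
rewrite factorial_moment_singleton // EfracZ Efrac_sum subn1 /=.
rewrite /bell_poly rmorphM rmorphM rmorphXn rmorphN1 rmorph_nat rmorph_sum /=.
rewrite -[_ / _ * _]mulrA; congr (_ * _); rewrite mulr_sumr.
apply: eq_bigr => P; rewrite inE => /andP [_ /eqP cardP].
rewrite !(big_enum_val (A := mem P)) /=.
rewrite (Efrac_prod_dot_power_sum hE hchi halphas_sim halphas_unc hchis_sim
  hchis_unc hchis_alphas) card_ord.
by rewrite [X in (n ^_ X)%:R * _]cardP mulKf.
Qed.
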